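(* Let $\mathcal{R}$ be a terminating term rewrite system over a finite signature $\mathcal{F}$, and define $$f(n) := \max\{\mathrm{dh}(t^\sharp, \to_{\mathrm{DP}(\mathcal{R})/\mathcal{R}}) \mid |t| \leqslant n\}.$$ Then there exists $D \in \mathbb{N}$ such that for all $n \in \mathbb{N}$, $$\mathrm{dc}_{\mathcal{R}}(n) \leqslant 2^{2^{n \cdot 2^{D\cdot(f(n)+1)}}}.$$
   Context: $\mathcal{V}$ is a countably infinite set of variables and $\mathcal{T}(\mathcal{F},\mathcal{V})$ is the set of terms. $|t|$ is the size of $t$, i.e. the number of occurrences of function symbols and variables in $t$. A TRS $\mathcal{R}$ is a finite set of rules $l \to r$ with $l \notin \mathcal{V}$ and $\mathrm{Var}(r) \subseteq \mathrm{Var}(l)$. $\to_{\mathcal{R}}$ is its rewrite relation (closed under contexts and substitutions). A symbol is defined if it is the root of the left-hand side of some rule; $\mathcal{D}$ denotes the set of defined symbols. For a relation $\to$, the derivation height is $\mathrm{dh}(s,\to) = \max\{n \mid \exists t,\ s \to^n t\}$. The derivational complexity is $\mathrm{dc}_{\mathcal{R}}(n) = \max\{\mathrm{dh}(t,\to_{\mathcal{R}}) \mid |t| \leqslant n\}$. For each $f \in \mathcal{F}$ let $f^\sharp$ be a fresh symbol of the same arity. For a term $t$, $t^\sharp = t$ if $t$ is a variable, and $t^\sharp = f^\sharp(t_1,\dots,t_n)$ if $t = f(t_1,\dots,t_n)$. The set of dependency pairs is $$\mathrm{DP}(\mathcal{R}) = \{l^\sharp \to u^\sharp \mid l \to r \in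 \mathcal{R},\ u \text{ a subterm of } r,\ \mathrm{root}(u) \in \mathcal{D},\ u \text{ not a proper subterm of } l\}.$$ For TRSs $\mathcal{P}$ and $\mathcal{S}$ (over the signature extended by the marked symbols), the relative rewrite relation is $\to_{\mathcal{P}/\mathcal{S}} = \to_{\mathcal{S}}^* \cdot \to_{\mathcal{P}} \cdot \to_{\mathcal{S}}^*$. *)

(* Defs.v *)
From Stdlib Require Export Relation_Operators.
From Stdlib Require Import ClassicalEpsilon.
From mathcomp Require Export all_boot.
From mathcomp Require Export classical_sets cardinality.

Set Implicit Arguments.
Unset Strict Implicit.
Unset Printing Implicit Defensive.

Local Open Scope classical_set_scope.

Record signature := Signature { symbol :> finType; arity : symbol -> nat }.

(* The countably infinite set of variables is nat. *)
Inductive term (F : signature) : Type :=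
| Var of nat
| App (f : F) of {ffun 'I_(arity f) -> term F}.

Arguments Var {F} x.
Arguments App {F} f a.

Fixpoint tsize (F : signature) (t : term F) : nat :=
  match t with
  | Var _ => 1
  | App _ a => (\sum_i tsize (a i)).+1
  end.

Definition root (F : signature) (t : term F) : option F :=
  match t with
  | Var _ => None
  | App f _ => Some f
  end.

Fixpoint subst (F : signature) (s : nat -> term F) (t : term F) : term F :=
  match t with
  | Var x => s x
  | App f a => App f [ffun i => subst s (a i)]
  end.

Inductive subterm (F : signature) (u : term F) : term F -> Prop :=
| subterm_refl : subterm u u
| subterm_arg (f : F) (a : {ffun 'I_(arity f) -> term F}) (i : 'I_(arity f)) :
    subterm u (a i) -> subterm u (App f a).

Definition proper_subterm (F : signature) (u t : term F) : Prop :=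
  subterm u t /\ u <> t.

Definition vars (F : signature) (t : term F) : set nat :=
  [set x | subterm (Var x) t].

Definition rule (F : signature) : Type := (term F * term F)%type.

Definition is_trs (F : signature) (R : set (rule F)) : Prop :=
  finite_set R /\
  forall l r, R (l, r) -> root l <> None /\ vars r `<=` vars l.

Inductive rewrite (F : signature) (R : set (rule F)) : term F -> term F -> Prop :=
| rewrite_root (l r : term F) (s : nat -> term F) :
    R (l, r) -> rewrite R (subst s l) (subst s r)
| rewrite_arg (f : F) (a b : {ffun 'I_(arity f) -> term F}) (i : 'I_(arity f)) :
    rewrite R (a i) (b i) -> (forall j, j != i -> a j = b j) ->
    rewrite R (App f a) (App f b).

Definition terminating (T : Type) (step : T -> T -> Prop) : Prop :=
  ~ exists s : nat -> T, forall i, step (s i) (s i.+1).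

Definition defined_symbol (F : signature) (R : set (rule F)) : set F :=
  [set f | exists l r, R (l, r) /\ root l = Some f].

(* Among the symbols F + F, [inl f] is f itself and [inr f] is its marked copy. *)
Definition marked (F : signature) : signature :=
  @Signature (F + F)%type
    (fun g => match g with inl f => arity f | inr f => arity f end).

Fixpoint embed (F : signature) (t : term F) : term (marked F) :=
  match t with
  | Var x => Var x
  | App f a => @App (marked F) (inl f) [ffun i => embed (a i)]
  end.

Definition embed_rules (F : signature) (R : set (rule F)) :
    set (rule (marked F)) :=
  [set (embed lr.1, embed lr.2) | lr in R].

Definition sharp (F : signature) (t : term F) : term (marked F) :=
  match t with
  | Var x => Var x
  | App f a => @App (marked F) (inr f) [ffun i => embed (a i)]
  end.

Definition dependency_pairs (F : signature) (R : set (rule F)) :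
    set (rule (marked F)) :=
  [set p | exists l r u,
     [/\ R (l, r),
         subterm u r,
         exists2 f, root u = Some f & defined_symbol R f,
         ~ proper_subterm u l &
         p = (sharp l, sharp u)]].

Definition relative_rewrite (F : signature) (P S : set (rule F))
    (s t : term F) : Prop :=
  exists s' t',
    [/\ clos_refl_trans _ (rewrite S) s s',
        rewrite P s' t' &
        clos_refl_trans _ (rewrite S) t' t].

Fixpoint nsteps (T : Type) (step : T -> T -> Prop) (n : nat) (s t : T) : Prop :=
  match n with
  | 0 => s = t
  | n'.+1 => exists2 u, step s u & nsteps step n' u t
  end.

(* The maximum of a set of naturals, where the maximum of the empty set is 0
   (it occurs below, as no term has size 0).  On an unbounded set, [epsilon]
   returns an unspecified natural rather than a fixed default such as 0. *)
Definition is_max (A : set nat) (m : nat) : Prop :=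
  (A m \/ A = set0 /\ m = 0) /\ forall k, A k -> k <= m.

Definition max_of (A : set nat) : nat := epsilon (inhabits 0) (is_max A).

Definition dh (T : Type) (step : T -> T -> Prop) (s : T) : nat :=
  max_of [set n | exists t, nsteps step n s t].

Definition dc (F : signature) (R : set (rule F)) (n : nat) : nat :=
  max_of [set dh (rewrite R) t | t in [set t : term F | tsize t <= n]].

Definition dp_complexity (F : signature) (R : set (rule F)) (n : nat) : nat :=
  max_of [set dh (relative_rewrite (dependency_pairs R) (embed_rules R)) (sharp t)
         | t in [set t : term F | tsize t <= n]].

(* Main.v *)
(** Weigh each node of a term by [K ^ m], where [m] exceeds its rank, the length
    of the longest DP chain from it.  Contracting a redex trades its root for at
    most [K] nodes of smaller rank per path, [K] bounding the depth of right-hand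
    sides, so path weights never increase.  Hence every term reachable from a
    term of size [n] has depth at most [n * K ^ (f n + 1)].  After identifying
    all variables there are doubly exponentially many terms of such depth, and a
    derivation of a terminating system cannot repeat any of them. *)
Require Import Defs.
From Stdlib Require Import ClassicalEpsilon.
From mathcomp Require Import boolp zify.

Set Implicit Arguments.
Unset Strict Implicit.
Unset Printing Implicit Defensive.

Local Open Scope classical_set_scope.

(** * Termination and derivation lengths in abstract rewriting *)

Section AbstractSteps.
Variables (T : Type) (step : T -> T -> Prop).

Lemma nsteps_cat m n x y z :
  nsteps step m x y -> nsteps step n y z -> nsteps step (m + n) x z.
Proof.
elim: m x => [|m IHm] x /=; first by move->.
by case=> u xu uy yz; exists u => //; apply: IHm.
Qed.

(** An inaccessible element has an inaccessible successor, so choice would yield an infinite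
    derivation. *)
Lemma terminating_Acc : terminating step ->
  forall x, Acc (fun v u => step u v) x.
Proof.
move=> term_step x; apply: contrapT => nAccx.
pose bad := {u : T | ~ Acc (fun v u => step u v) u}.
have next (u : bad) : exists v : bad, step (sval u) (sval v).
  case: u => u /= nAccu; apply: contrapT => no_next; apply: nAccu.
  constructor=> v uv; apply: contrapT => nAccv; apply: no_next.
  by exists (exist _ v nAccv).
have [g gP] := choice next.
apply: term_step; exists (fun n => sval (iter n g (exist _ x nAccx))) => n.
exact: gP.
Qed.

Lemma terminating_irreflexive : terminating step ->
  forall x n, ~ nsteps step n.+1 x x.
Proof.
move=> /terminating_Acc wf x; elim: (wf x) => {}x _ IHx n [u xu ux].
(* The cycle is rotated to start at [u], where the induction hypothesis applies. *)
by apply: (IHx u xu n); rewrite -addn1; apply: nsteps_cat ux _; exists u.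
Qed.

Lemma nsteps_seq n x y : nsteps step n x y ->
  exists2 s : nat -> T, s 0 = x & forall i, i < n -> step (s i) (s i.+1).
Proof.
elim: n x => [|n IHn] x /=; first by exists (fun=> x).
case=> u xu /IHn [s s0 sP].
exists (fun i => if i is j.+1 then s j else x) => // -[|i]; first by rewrite s0.
exact: sP.
Qed.

Lemma seq_nsteps (s : nat -> T) n : (forall i, i < n -> step (s i) (s i.+1)) ->
  forall i j, i + j <= n -> nsteps step j (s i) (s (i + j)).
Proof.
move=> sP i j; elim: j i => [|j IHj] i ijn /=; first by rewrite addn0.
exists (s i.+1); first by apply: sP; lia.
by rewrite -addSnnS; apply: IHj; lia.
Qed.

Lemma finite_set_bounded_choice (A : set T) (P : T -> nat -> Prop) :
    finite_set A ->
    (forall x m n, P x m -> m <= n -> P x n) ->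
    (forall x, A x -> exists n, P x n) ->
  exists n, forall x, A x -> P x n.
Proof.
move=> finA monoP exP.
have /choice [g gP] x : exists n, A x -> P x n.
  by have [/exP [n]|nAx] := EM (A x); [exists n | exists 0].
have /finite_seqP [s gAs] := finite_image g finA.
exists (\max_(i <- s) i) => x Ax; apply: monoP (gP x Ax) _.
have: [set` s] (g x) by rewrite -gAs; exists x.
by move=> gx_s; apply: (@leq_bigmax_seq _ s predT id).
Qed.

(** König's argument by well-founded induction: one more than a common bound for the finitely many
    successors. *)
Lemma terminating_bounded : terminating step ->
    (forall x, finite_set [set y | step x y]) ->
  forall x, exists B, forall n y, nsteps step n x y -> n <= B.
Proof.
move=> /terminating_Acc wf fin x; elim: (wf x) => {}x _ IHx.
have [|B BP] := finite_set_bounded_choice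
    (P := fun u B => forall n y, nsteps step n u y -> n <= B) (fin x) _ IHx.
  by move=> u m n mP mn k y /mP km; apply: leq_trans km mn.
by exists B.+1 => -[//|n] y [u xu uy]; apply: BP uy.
Qed.

End AbstractSteps.

(** * Maxima of bounded sets of naturals *)

Section MaxOf.

(** The bound matters: on an unbounded set [max_of] is unspecified, so every use below first bounds
    its set. *)
Lemma is_max_max_of (A : set nat) B : (forall k, A k -> k <= B) ->
  is_max A (max_of A).
Proof.
move=> AB; apply: epsilon_spec.
have [[k Ak]|noA] := EM (exists k, A k); last first.
  exists 0; split=> [|k Ak]; last by case: noA; exists k.
  by right; split=> //; apply/seteqP; split=> // k Ak; case: noA; exists k.
have exA : exists k, `[< A k >] by exists k; apply/asboolP.
have leB k' : `[< A k' >] -> k' <= B by move/asboolP/AB.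
have [m /asboolP Am mP] := ex_maxnP exA leB.
by exists m; split=> [|k' Ak']; [left | apply/mP/asboolP].
Qed.

Lemma max_of_le (A : set nat) B : (forall k, A k -> k <= B) -> max_of A <= B.
Proof. by move=> AB; have [[/AB //|[_ ->]] _] := is_max_max_of AB. Qed.

Lemma le_max_of (A : set nat) B k : (forall k, A k -> k <= B) ->
  A k -> k <= max_of A.
Proof. by move=> AB; have [_ +] := is_max_max_of AB; apply. Qed.

End MaxOf.

(** * Terms, substitutions and finite branching *)

Section Terms.
Variable F : signature.
Implicit Types (s t u : term F) (R : set (rule F)).

Lemma term_ind' (P : term F -> Prop) :
    (forall x, P (Var x)) ->
    (forall (f : F) (a : {ffun 'I_(arity f) -> term F}),
      (forall i, P (a i)) -> P (App f a)) ->
  forall t, P t.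
Proof.
move=> PV PA; fix IH 1 => -[x|f a]; first exact: PV.
by apply: PA => i; apply: IH.
Qed.

(** Symbols have decidable equality, so a dependent pair over them determines its second
    component. *)
Lemma App_inj (f : F) (a b : {ffun 'I_(arity f) -> term F}) :
  App f a = App f b -> a = b.
Proof.
pose args t := if t is App g c
  then Some (Tagged (fun g : F => {ffun 'I_(arity g) -> term F}) c) else None.
by move=> /(congr1 args) /Some_inj; apply: eq_from_Tagged.
Qed.

Lemma eq_subst (g h : nat -> term F) t :
  (forall x, vars t x -> g x = h x) -> subst g t = subst h t.
Proof.
elim/term_ind': t => [x|f a IHa] gh /=; first by apply: gh; constructor.
congr (App f _); apply/ffunP=> i; rewrite !ffunE; apply: IHa => x xa.
by apply: gh; apply: subterm_arg xa.
Qed.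

Lemma subst_eq_vars (g h : nat -> term F) t : subst g t = subst h t ->
  forall x, vars t x -> g x = h x.
Proof.
rewrite /vars /= => + x xt; elim: xt => //= f a i _ IHi /App_inj/ffunP/(_ i).
by rewrite !ffunE.
Qed.

Lemma subterm_inv u t : subterm u t ->
  u = t \/ if t is App f a then exists i, subterm u (a i) else False.
Proof. by case=> [|f a i ui]; [left | right; exists i]. Qed.

Lemma subterm_trans s t u : subterm s t -> subterm t u -> subterm s u.
Proof. by move=> st; elim=> // f a i _; apply: subterm_arg. Qed.

Lemma subst_subterm (g : nat -> term F) u t :
  subterm u t -> subterm (subst g u) (subst g t).
Proof.
elim=> [|f a i _ IHi]; first by constructor.
by apply: (subterm_arg (i := i)); rewrite ffunE.
Qed.

Lemma tsize_subterm u t : subterm u t -> tsize u <= tsize t.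
Proof.
elim=> //= f a i _ ui; apply: leq_trans ui _; apply: ltnW.
by rewrite ltnS (bigD1 i) //= leq_addr.
Qed.

Lemma tsize_subst_Var (g : nat -> nat) t :
  tsize (subst (fun x => Var (g x)) t) = tsize t.
Proof.
elim/term_ind': t => //= f a IHa; congr _.+1.
by apply: eq_bigr => i _; rewrite ffunE.
Qed.

Fixpoint depth (t : term F) : nat :=
  if t is App _ a then (\max_i depth (a i)).+1 else 0.

Lemma depth_le_tsize t : depth t <= tsize t.
Proof.
elim/term_ind': t => //= f a IHa; rewrite ltnS; apply/bigmax_leqP => i _.
by apply: leq_trans (IHa i) _; rewrite (bigD1 i) //= leq_addr.
Qed.

Lemma subst_comp (g h : nat -> term F) t :
  subst g (subst h t) = subst (subst g \o h) t.
Proof.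
elim/term_ind': t => //= f a IHa; congr (App f _); apply/ffunP=> i.
by rewrite !ffunE.
Qed.

Lemma rewrite_subst R (g : nat -> term F) s t :
  rewrite R s t -> rewrite R (subst g s) (subst g t).
Proof.
elim=> [l r h Rlr|f a b i _ IHi ab] /=.
  by rewrite !subst_comp; apply: rewrite_root.
apply: (rewrite_arg (i := i)) => [|j /ab eq_ab]; rewrite !ffunE //.
by rewrite eq_ab.
Qed.

Lemma nsteps_subst R (g : nat -> term F) n s t :
  nsteps (rewrite R) n s t -> nsteps (rewrite R) n (subst g s) (subst g t).
Proof.
elim: n s => [|n IHn] s /= => [->//|[u su /IHn ut]].
by exists (subst g u) => //; apply: rewrite_subst.
Qed.

Lemma nsteps_subterm R n u u' t : nsteps (rewrite R) n u u' -> subterm u t ->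
  exists t', nsteps (rewrite R) n t t'.
Proof.
move=> + ut; elim: ut n u' => [|f a i _ IHi] n u' uu'; first by exists u'.
have [{u' uu' IHi} v] := IHi n u' uu'.
elim: n a => [|n IHn] a /=; first by exists (App f a).
case=> w aiw wv; pose b := [ffun j => if j == i then w else a j].
have [|t' bt'] := IHn b; first by rewrite ffunE eqxx.
exists t', (App f b) => //; apply: (rewrite_arg (i := i)).
  by rewrite ffunE eqxx.
by move=> j /negbTE ji; rewrite ffunE ji.
Qed.

(* Finite branching: a rule rewrites a given term at its root in at most one
   way, because the matching substitution is determined on [vars l]. *)
Lemma rewrite_finite R t : is_trs R -> finite_set [set u | rewrite R t u].
Proof.
move=> [finR varR].
have rootP s : finite_set
    [set u | exists l r g, [/\ R (l, r), s = subst g l & u = subst g r]].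
  have /choice [c cP] (lr : rule F) : exists u, forall g, R lr ->
      s = subst g lr.1 -> u = subst g lr.2.
    have [[Rlr [g ->]]|no] := EM (R lr /\ exists g, s = subst g lr.1).
      exists (subst g lr.2) => h _ eq_gh; apply: eq_subst => x xr.
      apply: subst_eq_vars eq_gh _ _.
      by case: lr Rlr xr => l r /varR [_ sub] /= /sub.
    by exists (Var 0) => g Rlr sg; case: no; split=> //; exists g.
  apply: sub_finite_set (finite_image c finR) => u [l [r [g [Rlr sl ->]]]].
  by exists (l, r) => //; apply: cP.
elim/term_ind': t => [x|f a IHa].
  apply: sub_finite_set (rootP (Var x)) => u /= xu.
  by case E: _ _ / xu (erefl (Var x : term F)) => [l r g Rlr|//]; exists l, r, g.
pose put i v := App f [ffun j => if j == i then v else a j].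
have: finite_set ([set u | exists l r g,
      [/\ R (l, r), App f a = subst g l & u = subst g r]] `|`
    \bigcup_(i in [set: 'I_(arity f)]) (put i @` [set v | rewrite R (a i) v])).
  rewrite finite_setU; split; first exact: rootP.
  by apply: bigcup_finite => [|i _]; [apply: finite_finset | apply: finite_image].
apply: sub_finite_set => u /= au.
move: (erefl (App f a)); case: {1}_ _ / au => [l r g Rlr|g b c i bc eq_bc] E.
  by left; exists l, r, g.
have fg : f = g by move: E => /(congr1 (@root F)) [].
case: g / fg b c i bc eq_bc E => b c i bc eq_bc /App_inj E.
right; exists i => //; exists (c i); first by rewrite -E.
congr (App f _); apply/ffunP=> j; rewrite ffunE.
by case: eqVneq => [->//|/eq_bc <-]; rewrite -E.
Qed.

End Terms.

(** * Ranks and chains of dependency pairs *)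

Section DependencyPairs.
Variables (F : signature) (R : set (rule F)).

Let DP_step := relative_rewrite (dependency_pairs R) (embed_rules R).

Lemma embed_subst (g : nat -> term F) t :
  embed (subst g t) = subst (@embed F \o g) (embed t).
Proof.
elim/term_ind': t => //= f a IHa; congr (@App (marked F) _ _).
by apply/ffunP=> i; rewrite !ffunE.
Qed.

Lemma sharp_subst (g : nat -> term F) t : root t <> None ->
  sharp (subst g t) = subst (@embed F \o g) (sharp t).
Proof.
case: t => //= f a _; congr (@App (marked F) _ _).
by apply/ffunP=> i; rewrite !ffunE embed_subst.
Qed.

Lemma rewrite_embed s t :
  rewrite R s t -> rewrite (embed_rules R) (embed s) (embed t).
Proof.
elim=> [l r g Rlr|f a b i _ IHi ab] /=.
  by rewrite !embed_subst; apply: rewrite_root; exists (l, r).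
apply: (rewrite_arg (F := marked F) (f := inl f) (i := i)) => [|j /ab eq_ab].
  by rewrite !ffunE.
by rewrite !ffunE eq_ab.
Qed.

Lemma rewrite_sharp_arg (f : F) (a b : {ffun 'I_(arity f) -> term F}) i :
    rewrite R (a i) (b i) -> (forall j, j != i -> a j = b j) ->
  rewrite (embed_rules R) (sharp (App f a)) (sharp (App f b)).
Proof.
move=> ai ab.
apply: (rewrite_arg (F := marked F) (f := inr f) (i := i)) => [|j /ab eq_ab].
  by rewrite !ffunE; apply: rewrite_embed.
by rewrite !ffunE eq_ab.
Qed.

(** Chain lengths are bounded directly instead of through [dh], which would be unspecified for
    unbounded chains. *)
Definition rank_lt (m : nat) (t : term F) : Prop :=
  forall k v, nsteps DP_step k (sharp t) v -> k < m.

Lemma rank_lt_gt0 m t : rank_lt m t -> 0 < m.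
Proof. by move/(_ 0 (sharp t)); apply. Qed.

Lemma rank_lt_rewrite_arg m (f : F) (a b : {ffun 'I_(arity f) -> term F}) i :
    rewrite R (a i) (b i) -> (forall j, j != i -> a j = b j) ->
  rank_lt m (App f a) -> rank_lt m (App f b).
Proof.
move=> ai ab ra k u; case: k => [|k] bu; first exact: rank_lt_gt0 ra.
(* The step in the argument is absorbed into the rewriting that precedes the first pair step. *)
case: bu => v [s' [t' [bs st tv]]] vu; apply: (ra _ u); exists v => //.
exists s', t'; split=> //; apply: rt_trans bs.
exact/rt_step/rewrite_sharp_arg/ab.
Qed.

(** A pair step from [sharp (subst g l)], prepended to a chain, lengthens it by one. *)
Lemma rank_lt_dp m l r u (g : nat -> term F) : R (l, r) -> root l <> None ->
    subterm u r -> (exists2 f, root u = Some f & defined_symbol R f) ->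
    ~ proper_subterm u l ->
  rank_lt m (subst g l) -> rank_lt m.-1 (subst g u).
Proof.
move=> Rlr l_app ur u_def u_new rl k v uv.
have u_app: root u <> None by case: u_def => f ->.
suff: k.+1 < m by lia.
apply: (rl _ v); exists (sharp (subst g u)) => //.
exists (sharp (subst g l)), (sharp (subst g u)).
split; [exact: rt_refl | | exact: rt_refl].
by rewrite !sharp_subst //; apply: rewrite_root; exists l, r, u.
Qed.

(** Forgetting marks relates chains to derivations of [R]; termination then bounds chain lengths,
    which makes the maximum in [dp_complexity] genuine. *)
Fixpoint erase (t : term (marked F)) : term F :=
  match t with
  | Var x => Var x
  | App g a =>
    match g return {ffun 'I_(@arity (marked F) g) -> term (marked F)} -> term F with
    | inl f => fun a => App f [ffun i => erase (a i)]
    | inr f => fun a => App f [ffun i => erase (a i)]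
    end a
  end.

Lemma erase_embed t : erase (embed t) = t.
Proof.
elim/term_ind': t => //= f a IHa; congr (App f _).
by apply/ffunP=> i; rewrite !ffunE.
Qed.

Lemma erase_sharp t : erase (sharp t) = t.
Proof.
case: t => //= f a; congr (App f _).
by apply/ffunP=> i; rewrite !ffunE erase_embed.
Qed.

Lemma erase_subst (g : nat -> term (marked F)) t :
  erase (subst g t) = subst (erase \o g) (erase t).
Proof.
elim/term_ind': t => // -[] f a IHa /=; congr (App f _);
  by apply/ffunP=> i; rewrite !ffunE IHa.
Qed.

Lemma erase_rewrite s t :
  rewrite (embed_rules R) s t -> rewrite R (erase s) (erase t).
Proof.
elim=> [l r g [[l0 r0] Rlr [<- <-]]|[] f a b i _ IHi ab] /=.
- by rewrite !erase_subst !erase_embed; apply: rewrite_root.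
- apply: (rewrite_arg (F := F) (f := f) (i := i)) => [|j /ab eq_ab]; rewrite !ffunE //.
  by rewrite eq_ab.
- apply: (rewrite_arg (F := F) (f := f) (i := i)) => [|j /ab eq_ab]; rewrite !ffunE //.
  by rewrite eq_ab.
Qed.

Fixpoint unmarked (t : term (marked F)) : Prop :=
  match t with
  | Var _ => True
  | App g a => if g is inl _ then forall i, unmarked (a i) else False
  end.

Definition unmarked_args (t : term (marked F)) : Prop :=
  if t is App _ a then forall i, unmarked (a i) else True.

Lemma unmarkedW t : unmarked t -> unmarked_args t.
Proof. by case: t => //= -[]. Qed.

Lemma unmarked_subst_embed (g : nat -> term (marked F)) t :
  unmarked (subst g (embed t)) <-> forall x, vars t x -> unmarked (g x).
Proof.
elim/term_ind': t => [x|f a IHa] /=.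
  split=> [gx y /subterm_inv [[->]|]|] //; apply; constructor.
split=> [ga x /subterm_inv [//|[i xi]]|ga i].
  by have := ga i; rewrite !ffunE => /IHa; apply.
by rewrite !ffunE; apply/IHa => x xi; apply: ga; apply: subterm_arg xi.
Qed.

Lemma unmarked_args_subst_sharp (g : nat -> term (marked F)) t :
    root t <> None ->
  unmarked_args (subst g (sharp t)) <-> forall x, vars t x -> unmarked (g x).
Proof.
case: t => // f a _; split=> [ga x /subterm_inv [//|[i xi]]|ga i].
  by have := ga i; rewrite !ffunE => /unmarked_subst_embed; apply.
rewrite !ffunE; apply/unmarked_subst_embed => x xi.
by apply: ga; apply: subterm_arg xi.
Qed.

Hypothesis R_trs : is_trs R.

Lemma rewrite_unmarked s t :
  rewrite (embed_rules R) s t -> unmarked s -> unmarked t.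
Proof.
elim=> [l r g [[l0 r0] Rlr [<- <-]]|[] f a b i _ IHi ab] //.
  move=> /unmarked_subst_embed gl; apply/unmarked_subst_embed => x xr.
  by apply: gl; have [_ /(_ _ _ Rlr) [_ +]] := R_trs; apply.
move=> ua j; have [->|/ab <-] := eqVneq j i; [exact/IHi/ua | exact: ua].
Qed.

Lemma rewrite_unmarked_args s t :
  rewrite (embed_rules R) s t -> unmarked_args s -> unmarked_args t.
Proof.
move=> st; move: (st); case: st => [l r g [[l0 r0] Rlr [<- <-]] st|g a b i ai ab _].
  (* The redex is an instance of an embedded non-variable left-hand side, so its root is unmarked as
     well. *)
  move=> us; apply: unmarkedW; apply: rewrite_unmarked st _.
  have [_ /(_ _ _ Rlr) [l_app _]] := R_trs.
  by case: l0 l_app us {Rlr}.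
move=> ua j; have [->|/ab <-] := eqVneq j i; last exact: ua.
by apply: rewrite_unmarked ai _; apply: ua.
Qed.

(* Marked symbols occur only at the root of the terms of a DP chain, so its DP
   steps contract the root. *)
Lemma erase_dp_step s t :
  rewrite (dependency_pairs R) s t -> unmarked_args s ->
  unmarked_args t /\ exists2 v, rewrite R (erase s) v & subterm (erase t) v.
Proof.
have not_unmarked u v : rewrite (dependency_pairs R) u v -> ~ unmarked u.
  elim=> [_ _ g [l [r [w [Rlr _ _ _ [-> _]]]]]|[] f a b i _ IHi _] //.
    have [_ /(_ _ _ Rlr) [l_app _]] := R_trs.
    by case: l l_app {Rlr} => [x []|f a _ []].
case=> [l' r' g [l [r [u [Rlr ur [f u_f _] _ [-> ->]]]]]|g a b i ai ab] us.
  have [_ /(_ _ _ Rlr) [l_app rl]] := R_trs.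
  have u_app : root u <> None by rewrite u_f.
  split.
    apply/unmarked_args_subst_sharp => // x xu.
    move: us => /unmarked_args_subst_sharp; apply=> //.
    by apply: rl; apply: subterm_trans xu ur.
  exists (subst (erase \o g) r); rewrite erase_subst erase_sharp.
    exact: rewrite_root.
  exact: subst_subterm.
by case: (not_unmarked _ _ ai); apply: us.
Qed.

(** After erasure, each pair step becomes a rewrite step to a term containing the next chain term as
    a subterm; the rest of the derivation is replayed inside that larger term. *)
Lemma nsteps_dp_erase k s t :
  nsteps DP_step k s t -> unmarked_args s ->
  exists2 n, k <= n & exists v, nsteps (rewrite R) n (erase s) v.
Proof.
have rt_erase u v : clos_refl_trans _ (rewrite (embed_rules R)) u v ->
    unmarked_args u ->
    unmarked_args v /\ exists n, nsteps (rewrite R) n (erase u) (erase v).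
  elim=> [x y xy ux|x ux|x y z _ IHxy _ IHyz ux].
  - split; first exact: rewrite_unmarked_args xy ux.
    by exists 1, (erase y) => //; apply: erase_rewrite.
  - by split=> //; exists 0.
  - have [uy [m xy]] := IHxy ux; have [uz [n yz]] := IHyz uy.
    by split=> //; exists (m + n); apply: nsteps_cat xy yz.
elim: k s => [|k IHk] s /=; first by exists 0 => //; exists (erase s).
move=> [u [s' [t' [ss st tu]]] ut] us.
have [us' [m sm]] := rt_erase _ _ ss us.
have [ut' [v sv tv]] := erase_dp_step st us'.
have [uu [n tn]] := rt_erase _ _ tu ut'.
have [q kq [w uw]] := IHk _ ut uu.
have [x vx] := nsteps_subterm (nsteps_cat tn uw) tv.
exists (m + (n + q).+1); first lia.
by exists x; apply: nsteps_cat sm _; exists v.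
Qed.

Lemma nsteps_dp_sharp k s t : nsteps DP_step k (sharp s) t ->
  exists2 n, k <= n & exists v, nsteps (rewrite R) n s v.
Proof.
move/nsteps_dp_erase; rewrite erase_sharp; apply.
have embed_unmarked u : unmarked (embed u).
  by elim/term_ind': u => //= f a IHa i; rewrite ffunE.
by case: s => //= f a i; rewrite ffunE.
Qed.

End DependencyPairs.

(** * Path weights as an invariant of rewriting *)

Section PathWeight.
Variables (F : signature) (R : set (rule F)) (K : nat).

(* Along every root-to-leaf path of [t], nodes can be given weights [K ^ m]
   summing to at most [w], where [m] exceeds the rank of the subterm at the node
   if its root is defined; variables weigh nothing. *)
Fixpoint path_weight_le (t : term F) (w : nat) : Prop :=
  match t with
  | Var _ => True
  | App f a => exists m w',
      [/\ K ^ m + w' <= w,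
          defined_symbol R f -> rank_lt R m (App f a) &
          forall i, path_weight_le (a i) w']
  end.

Lemma path_weight_leW t w1 w2 :
  w1 <= w2 -> path_weight_le t w1 -> path_weight_le t w2.
Proof.
case: t => //= f a w12 [m [w [mw ra wa]]]; exists m, w; split=> //.
exact: leq_trans mw w12.
Qed.

Lemma path_weight_le_subterm u t w :
  subterm u t -> path_weight_le t w -> path_weight_le u w.
Proof.
move=> ut; elim: ut w => //= f a i _ IHi w [m [w' [mw _ wa]]].
by apply: path_weight_leW (IHi _ (wa i)); lia.
Qed.

Hypothesis K_gt0 : 0 < K.

Lemma depth_le_path_weight t w : path_weight_le t w -> depth t <= w.
Proof.
elim/term_ind': t w => //= f a IHa w [m [w' [mw _ wa]]].
apply: leq_trans mw; rewrite -add1n leq_add ?expn_gt0 ?K_gt0 //.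
by apply/bigmax_leqP => i _; apply: IHa.
Qed.

(** Every function symbol receives the same weight [K ^ m]. *)
Lemma path_weight_le_init m t :
    (forall u, subterm u t -> rank_lt R m u) ->
  path_weight_le t (depth t * K ^ m).
Proof.
elim/term_ind': t => //= f a IHa rt.
exists m, ((\max_i depth (a i)) * K ^ m); split=> [|_|i].
- by rewrite mulSn.
- by apply: rt; constructor.
- have: path_weight_le (a i) (depth (a i) * K ^ m).
    by apply: IHa => u ui; apply: rt; apply: subterm_arg ui.
  apply: path_weight_leW; rewrite leq_mul2r.
  by rewrite (leq_bigmax (F := fun i => depth (a i))) orbT.
Qed.

Hypothesis R_trs : is_trs R.
Hypothesis depth_rhs : forall l r, R (l, r) -> depth r <= K.

(* A symbol created by contracting a redex of rank below [m] gets exponent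
   [m.-1]: if it is defined and its subterm is not copied from the arguments of
   the redex, then a dependency pair leads to it.  At most [K] such symbols lie
   on a path, replacing the weight [K ^ m] of the root of the redex. *)
Lemma path_weight_le_contract l r g w : R (l, r) ->
  path_weight_le (subst g l) w -> path_weight_le (subst g r) w.
Proof.
move=> Rlr; have [_ /(_ _ _ Rlr) [l_app rl]] := R_trs.
have l_def f : root l = Some f -> defined_symbol R f by exists l, r.
have rank_created := rank_lt_dp Rlr l_app.
case: l Rlr l_app l_def rl rank_created => // f a Rlr _ f_def rl rank_created.
case=> m [w' [mw rank_l wa]]; have {f_def}rank_l := rank_l (f_def f erefl).
(* Instances of proper subterms of the left-hand side lie inside arguments of the redex, so the
   budget [w'] already covers them. *)
have below u : subterm u (App f a) -> u <> App f a ->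
    path_weight_le (subst g u) w'.
  move=> /subterm_inv [//|[i ui]] _; have := wa i; rewrite ffunE.
  by apply: path_weight_le_subterm; apply: subst_subterm.
(* The claim is generalized to subterms of [r] for induction; at [r] itself, [depth r <= K] and
   [K * K ^ m.-1 = K ^ m], as [m] is positive. *)
suff created u : subterm u r ->
    path_weight_le (subst g u) (depth u * K ^ m.-1 + w').
  apply: path_weight_leW (created r (subterm_refl _)); apply: leq_trans mw.
  rewrite leq_add2r -[in K ^ m](prednK (rank_lt_gt0 rank_l)) expnS.
  by rewrite leq_mul2r (depth_rhs Rlr) orbT.
elim/term_ind': u => [x xr|h b IHb br].
  by apply: path_weight_leW (below _ (rl _ xr) _); first lia.
have [[bl nbl]|b_new] := EM (proper_subterm (App h b) (App f a)).
  by apply: path_weight_leW (below _ bl nbl); lia.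
exists m.-1, ((\max_i depth (b i)) * K ^ m.-1 + w'); split=> [|h_def|i] /=.
- by rewrite mulSn addnA.
- by apply: (rank_created m (App h b) g br) => //; exists h.
- rewrite ffunE; have: subterm (b i) r.
    by apply: subterm_trans br; apply: (subterm_arg (i := i)); constructor.
  move/IHb; apply: path_weight_leW; rewrite leq_add2r leq_mul2r.
  by rewrite (leq_bigmax (F := fun i => depth (b i))) orbT.
Qed.

Lemma path_weight_le_rewrite s t w :
  rewrite R s t -> path_weight_le s w -> path_weight_le t w.
Proof.
move=> st; elim: st w => [l r g Rlr|f a b i ai IHi ab] w.
  exact: path_weight_le_contract.
case=> m [w' [mw ra wa]]; exists m, w'; split=> // [/ra|j].
  exact: rank_lt_rewrite_arg ai ab.
by have [->|/ab <-] := eqVneq j i; [apply/IHi/wa | apply: wa].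
Qed.

Lemma path_weight_le_nsteps n s t w :
  nsteps (rewrite R) n s t -> path_weight_le s w -> path_weight_le t w.
Proof.
elim: n s => [|n IHn] s /= => [->//|[u su ut] /(path_weight_le_rewrite su)].
exact: IHn.
Qed.

End PathWeight.

(** * Counting terms of bounded depth over one variable *)

Section Counting.
Variable F : signature.

(** Being a substitution, it maps derivations to derivations of the same length. *)
Definition collapse (t : term F) : term F := subst (fun=> Var 0) t.

Definition max_arity : nat := \max_(f : F) arity f.

Lemma arity_le_max (f : F) : arity f <= max_arity.
Proof. exact: (leq_bigmax (F := fun f : F => arity f)). Qed.

(* Codes for the terms of depth at most [h] over one variable; components beyond
   the arity of the root symbol are ignored. *)
Fixpoint term_code (h : nat) : finType :=
  if h is h'.+1 then option (F * {ffun 'I_max_arity -> term_code h'}) : finType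
  else unit.

Fixpoint decode (h : nat) : term_code h -> term F :=
  match h with
  | 0 => fun=> Var 0
  | h'.+1 => fun c : option (F * {ffun 'I_max_arity -> term_code h'}) =>
    if c is Some (f, a)
    then App f [ffun i => decode (a (widen_ord (arity_le_max f) i))]
    else Var 0
  end.

Lemma decode_collapse h t : depth t <= h -> exists c : term_code h,
  decode c = collapse t.
Proof.
elim/term_ind': t h => [x h _|f a IHa [//|h] /=].
  by case: h => [|h]; [exists tt | exists None].
rewrite ltnS => /bigmax_leqP ah.
have /choice [c cP] i := IHa i h (ah i isT).
(* [c0] fills the components beyond the arity of [f]. *)
have [c0 _] : exists c : term_code h, decode c = collapse (Var 0).
  by case: (h) => [|?]; [exists tt | exists None].
exists (Some (f, [ffun j => if insub (val j) is Some i then c i else c0])).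
congr (App f _); apply/ffunP => i; rewrite !ffunE /= -[RHS]cP.
by case: insubP => [j _ /val_inj ->//|]; rewrite ltn_ord.
Qed.

Lemma card_term_code h :
  #|term_code h| <= #|F|.+2 ^ (max_arity.+1 ^ h).
Proof.
elim: h => [|h IHh]; first by rewrite card_unit expn1.
rewrite card_option card_prod card_ffun card_ord.
set X := max_arity.+1 ^ h in IHh *; set B := #|F|.+2 in IHh *.
have X_gt0 : 0 < X by rewrite expn_gt0.
have pow_le : #|term_code h| ^ max_arity <= B ^ (X * max_arity).
  by rewrite expnM; have [->|A_gt0] := posnP max_arity; rewrite ?expn0 ?leq_exp2r.
(* As [B] exceeds [#|F|] by two, two spare copies of the power absorb the code of the variable; also
   [B > 1] even for an empty signature. *)
apply: (@leq_trans (B ^ (X * max_arity).+1)).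
  rewrite expnS !mulSn addnA -addn1 [leqRHS]addnC leq_add ?leq_mul //.
  by rewrite addn_gt0 expn_gt0.
by rewrite leq_exp2l // expnS mulSn mulnC -add1n leq_add2r.
Qed.

(* No term repeats along a derivation of a terminating system. *)
Lemma derivation_lt_card R h n t u : terminating (rewrite R) ->
    nsteps (rewrite R) n t u ->
    (forall k v, k <= n -> nsteps (rewrite R) k (collapse t) v -> depth v <= h) ->
  n < #|term_code h|.
Proof.
move=> R_term tu depth_le.
have [s s0 sP] := nsteps_seq (nsteps_subst (fun=> Var 0) tu).
have seqP i j : i + j <= n -> nsteps (rewrite R) j (s i) (s (i + j)).
  exact: (seq_nsteps sP).
have /choice [c cP] (i : 'I_n.+1) : exists c : term_code h,
    decode c = collapse (s i).
  apply: decode_collapse; apply: (depth_le i); first by rewrite -ltnS.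
  by have := seqP 0 i; rewrite s0 add0n; apply; rewrite -ltnS.
have c_inj : injective c.
  suff lt_neq (i j : 'I_n.+1) : i < j -> c i <> c j.
    move=> i j cij; apply: val_inj => /=.
    by case: (ltngtP i j) => // /lt_neq; rewrite cij.
  move=> ij cij; have ijn : i + (j - i) <= n by have := ltn_ord j; lia.
  (* Codes only determine [collapse (s i)], so the segment from [s i] to [s j] is collapsed once
     more to close a cycle. *)
  have := nsteps_subst (fun=> Var 0) (seqP _ _ ijn).
  rewrite subnKC 1?ltnW // -/(collapse (s i)) -/(collapse (s j)) -!cP cij.
  have -> : j - i = (j - i).-1.+1 by rewrite prednK // subn_gt0.
  exact: (terminating_irreflexive R_term).
by have := leq_card c c_inj; rewrite card_ord.
Qed.

End Counting.

(** * Uniform bounds on derivation lengths, ranks and depths *)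

Section Bounds.
Variables (F : signature) (R : set (rule F)).
Hypotheses (R_trs : is_trs R) (R_term : terminating (rewrite R)).

(** Infinitely many terms have size at most [n], but collapsing preserves derivation lengths and
    leaves finitely many codes, whose individual bounds have a maximum. *)
Lemma nsteps_bounded_tsize n : exists B, forall t k u,
  tsize t <= n -> nsteps (rewrite R) k t u -> k <= B.
Proof.
have bounded := terminating_bounded R_term (fun t => rewrite_finite t R_trs).
have [b bP] := choice bounded.
exists (\max_(c : term_code F n) b (decode c)) => t k u tn tu.
have [c ct] := decode_collapse (leq_trans (depth_le_tsize t) tn).
apply: leq_trans (leq_bigmax (F := fun c => b (decode c)) c).
by apply: bP; rewrite ct; apply: nsteps_subst tu.
Qed.

Lemma rank_lt_dp_complexity n t :
  tsize t <= n -> rank_lt R (dp_complexity R n).+1 t.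
Proof.
move=> tn k v tv; have [B BP] := nsteps_bounded_tsize n.
have dp_le u j w : tsize u <= n -> nsteps (relative_rewrite
    (dependency_pairs R) (embed_rules R)) j (sharp u) w -> j <= B.
  move=> un /(nsteps_dp_sharp R_trs) [i ji [x ux]].
  exact: leq_trans ji (BP _ _ _ un ux).
(* [B] bounds both the set behind [dh] and the one behind [dp_complexity], so both are true
   maxima. *)
rewrite ltnS; apply: (@leq_trans (dh (relative_rewrite (dependency_pairs R)
    (embed_rules R)) (sharp t))).
  by apply: (le_max_of (B := B)); [move=> j [w] /dp_le; apply | exists v].
apply: (le_max_of (B := B)); last by exists t.
by move=> _ [u un <-]; apply: max_of_le => j [w] /dp_le; apply.
Qed.

Lemma depth_reachable K n t k u : 0 < K ->
    (forall l r, R (l, r) -> depth r <= K) -> tsize t <= n ->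
    nsteps (rewrite R) k t u ->
  depth u <= n * K ^ (dp_complexity R n).+1.
Proof.
move=> K_gt0 KP tn tu.
apply: (@leq_trans (depth t * K ^ (dp_complexity R n).+1)).
  apply: (depth_le_path_weight (R := R) K_gt0).
  apply: path_weight_le_nsteps tu _ => //.
  (* Subterms of [t] also have size at most [n], so one exponent serves all nodes. *)
  apply: path_weight_le_init => v vt; apply: rank_lt_dp_complexity.
  exact: leq_trans (tsize_subterm vt) tn.
by rewrite leq_mul2r (leq_trans (depth_le_tsize t) tn) orbT.
Qed.

End Bounds.

(** Repeated use of [m <= 2 ^ m], for [B], [A], [K] and [A + B], trades every base for 2. *)
Lemma leq_double_exp (B A K n d : nat) : 0 < A -> 0 < K -> 0 < n ->
  B ^ (A ^ (n * K ^ d.+1)) <= 2 ^ (2 ^ (n * 2 ^ ((A + B + K) * (d + 1)))).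
Proof.
move=> A_gt0 K_gt0 n_gt0; set h := n * K ^ d.+1.
have lt2 m : m <= 2 ^ m by apply/ltnW/ltn_expl.
have h_gt0 : 0 < h by rewrite muln_gt0 n_gt0 expn_gt0 K_gt0.
apply: (@leq_trans ((2 ^ B) ^ (A ^ h))).
  by rewrite leq_exp2r ?expn_gt0 ?A_gt0.
rewrite -expnM leq_exp2l //; apply: (@leq_trans (2 ^ B * (2 ^ A) ^ h)).
  by rewrite leq_mul // leq_exp2r.
(* Since [h] is positive, [B + A * h] is at most [(A + B) * h]. *)
rewrite -expnM -expnD leq_exp2l //; apply: (@leq_trans ((A + B) * h)); first nia.
rewrite mulnC -mulnA leq_mul2l; apply/orP; right.
apply: (@leq_trans ((2 ^ K) ^ d.+1 * 2 ^ (A + B))).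
  by rewrite leq_mul // leq_exp2r.
by rewrite -expnM -expnD leq_exp2l //; nia.
Qed.

Theorem theorem5p12 (F : signature) (R : set (rule F))
    (R_trs : is_trs R) (R_terminating : terminating (rewrite R)) :
  exists D : nat, forall n : nat,
    dc R n <= 2 ^ (2 ^ (n * 2 ^ (D * (dp_complexity R n + 1)))).
Proof.
have [K0 K0P] : exists K, forall lr : rule F, R lr -> depth lr.2 <= K.
  apply: (finite_set_bounded_choice (P := fun lr K => depth lr.2 <= K)).
  - by case: R_trs.
  - by move=> lr m n; apply: leq_trans.
  - by move=> lr _; exists (depth lr.2).
(* The successor keeps the base of the weights positive even when all right-hand sides are
   variables. *)
have KP l r : R (l, r) -> depth r <= K0.+1 by move/K0P/leqW.
exists ((max_arity F).+1 + #|F|.+2 + K0.+1) => n.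
apply: max_of_le => _ [t /= tn <-]; apply: max_of_le => k [u tu].
(* The existence of [t] excludes [n = 0], where the maximum ranges over the empty set. *)
have n_gt0 : 0 < n by apply: leq_trans tn; case: (t).
apply: leq_trans (@leq_double_exp #|F|.+2 (max_arity F).+1 K0.+1 n _ _ _ _) => //.
apply: leq_trans (card_term_code F _).
apply/ltnW/(derivation_lt_card R_terminating tu) => i v _ tv.
(* Collapsing keeps the size, so the depth bound holds for derivations from [collapse t]. *)
by apply: (depth_reachable R_trs R_terminating _ KP _ tv); rewrite ?tsize_subst_Var.
Qed.
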